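(* For every graph $G$ of order greater than $1$, we have $\textnormal{ftedim}(G) \le \textnormal{edim}(G)\,(1+2^{\textnormal{edim}(G)})$.
   Context: Graphs are finite, simple, undirected, possibly disconnected; $\textnormal{dist}(u,v)=\infty$ between different components. For an edge $e=\{u,v\}$ and vertex $w$, $\textnormal{dist}(e,w)=\min(\textnormal{dist}(w,u),\textnormal{dist}(w,v))$. A set $S=\{v_1,\dots,v_k\}$ of vertices is an edge resolving set of $G$ if the vectors $(\textnormal{dist}(e,v_1),\dots,\textnormal{dist}(e,v_k))$ are pairwise distinct over all edges $e\in E(G)$. The edge metric dimension $\textnormal{edim}(G)$ is the minimum size of an edge resolving set. The fault-tolerant edge metric dimension $\textnormal{ftedim}(G)$ is the minimum size of a nonempty $S\subseteq V(G)$ such that $S-\{s\}$ is an edge resolving set for every $s\in S$. *)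

(* Defs.v *)
From HB Require Import structures.
From mathcomp Require Import all_boot.

Set Implicit Arguments.
Unset Strict Implicit.
Unset Printing Implicit Defensive.

Record sgraph := SGraph {
  vertex :> finType;
  adj : rel vertex;
  adj_sym : symmetric adj;
  adj_irrefl : irreflexive adj }.

(* Distances live in [option nat], with [None] standing for infinity. *)
Definition omin (x y : option nat) : option nat :=
  match x, y with
  | Some m, Some n => Some (minn m n)
  | Some _, None => x
  | None, _ => y
  end.

Lemma ominA : associative omin.
Proof. by move=> [m|] [n|] [p|] //=; rewrite minnA. Qed.

Lemma ominC : commutative omin.
Proof. by move=> [m|] [n|] //=; rewrite minnC. Qed.

Lemma omin0x : left_id None omin.
Proof. by []. Qed.

HB.instance Definition _ :=
  Monoid.isComLaw.Build (option nat) None omin ominA ominC omin0x.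

Section Distances.
Variable G : sgraph.
Implicit Types (u v w : G) (A B S : {set G}).

Definition edges : {set {set G}} :=
  [set A | [exists u, exists v, adj u v && (A == [set u; v])]].

Definition walk u v (n : nat) : bool :=
  [exists p : n.-tuple G, path (@adj G) u p && (last u p == v)].

Lemma connect_walk u v : connect (@adj G) u v -> exists n, walk u v n.
Proof.
case/connectP=> p up ->; exists (size p); apply/existsP.
by exists (in_tuple p); rewrite up eqxx.
Qed.

Definition dist u v : option nat :=
  if @idP (connect (@adj G) u v) is ReflectT uv
  then Some (ex_minn (connect_walk uv)) else None.

(* Meant for [A \in edges]; see [edge_dist2]. *)
Definition edge_dist A w : option nat := \big[omin/None]_(u in A) dist w u.

(* A resolving set {v_1, ..., v_k} is taken to have k >= 1.  This only matters
   for graphs with at most one edge, where the empty set would otherwise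
   qualify and give edim G = 0. *)
Definition edge_resolving S : bool :=
  (S != set0) &&
  [forall A in edges, forall B in edges,
     [forall s in S, edge_dist A s == edge_dist B s] ==> (A == B)].

Definition ft_edge_resolving S : bool :=
  (S != set0) && [forall s in S, edge_resolving (S :\ s)].

(* The base point [setT] of the minimization satisfies the constraint as soon
   as it can be satisfied at all: see [edge_resolvingT], [ft_edge_resolvingT]. *)
Definition edim : nat := #|[arg min_(S < [set: G] | edge_resolving S) #|S| ]|.

Definition ftedim : nat :=
  #|[arg min_(S < [set: G] | ft_edge_resolving S) #|S| ]|.

Lemma edge_dist2 u v w : u != v ->
  edge_dist [set u; v] w = omin (dist w u) (dist w v).
Proof. by move=> uv; rewrite /edge_dist big_setU1 ?inE //= big_set1. Qed.

Lemma dist_eq0 u v : (dist u v == Some 0) = (u == v).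
Proof.
rewrite /dist; case: {-}_ / idP => [uv|/negP nuv].
  case: ex_minnP => n /existsP[p /andP[_ /eqP lp]] nmin.
  apply/eqP/eqP => [[n0]|uv0].
    by move: p lp; rewrite n0 => p; rewrite tuple0.
  congr Some; apply/eqP; rewrite -leqn0; apply: nmin.
  by apply/existsP; exists [tuple]; rewrite /= uv0.
by apply/esym/negbTE; apply: contra nuv => /eqP->; apply: connect0.
Qed.

Lemma edge_dist_eq0 A w : (edge_dist A w == Some 0) = (w \in A).
Proof.
have omin0 x y : (omin x y == Some 0) = (x == Some 0) || (y == Some 0).
  by case: x y => [[|m]|] [[|n]|] //=; rewrite ?minn0 ?min0n ?minnSS.
apply/idP/idP => [|wA].
  rewrite /edge_dist; apply: (big_ind (fun d => d == Some 0 -> w \in A)) => //.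
    by move=> x y IHx IHy; rewrite omin0 => /orP[/IHx|/IHy].
  by move=> u uA; rewrite dist_eq0 => /eqP->.
rewrite /edge_dist (bigD1 w) //= omin0; apply/orP; left.
by rewrite dist_eq0.
Qed.

Lemma card_edge A : A \in edges -> #|A| = 2.
Proof.
rewrite inE => /existsP[u /existsP[v /andP[uv /eqP->]]].
by rewrite cards2; case: eqP uv => // ->; rewrite adj_irrefl.
Qed.

Lemma edge_resolvingD1 s : 1 < #|G| -> edge_resolving ([set: G] :\ s).
Proof.
move=> G1; apply/andP; split.
  by rewrite -card_gt0 -ltnS (leq_trans G1) // -cardsT (cardsD1 s) inE.
apply/'forall_implyP => A eA; apply/'forall_implyP => B eB.
apply/implyP => /'forall_implyP sAB.
have eqAB x : x != s -> (x \in A) = (x \in B).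
  by move=> xs; rewrite -!edge_dist_eq0 (eqP (sAB x _)) // !inE xs.
have AB : A :\ s = B :\ s.
  by apply/setP=> x; rewrite !inE; case: eqP => //= /eqP /eqAB.
have: (s \in A) + #|A :\ s| = (s \in B) + #|B :\ s|.
  by rewrite -!cardsD1 !card_edge.
rewrite AB => /addIn sAsB; apply/eqP/setP => x.
by have [->|/eqAB//] := eqVneq x s; case: (s \in A) (s \in B) sAsB => [] [].
Qed.

Lemma edge_resolvingT : 0 < #|G| -> edge_resolving [set: G].
Proof.
move=> G0; apply/andP; split; first by rewrite -card_gt0 cardsT.
apply/'forall_implyP => A _; apply/'forall_implyP => B _.
apply/implyP => /'forall_implyP sAB; apply/eqP/setP => x.
by rewrite -!edge_dist_eq0 (eqP (sAB x _)).
Qed.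

Lemma ft_edge_resolvingT : 1 < #|G| -> ft_edge_resolving [set: G].
Proof.
move=> G1; apply/andP; split; first by rewrite -card_gt0 cardsT (ltnW G1).
by apply/'forall_implyP => s _; apply: edge_resolvingD1.
Qed.

End Distances.

(* Main.v *)
Require Import Defs.
From mathcomp Require Import all_boot.

Set Implicit Arguments.
Unset Strict Implicit.
Unset Printing Implicit Defensive.

(** Let [S] be a minimum edge resolving set, [k] its size, and [v \in S].
    The edges at [v] are separated by [S :\ v], and each [s] sees an edge at
    [v] at distance [d(s,v)] or [d(s,v) - 1]; hence [v] has at most [2^(k-1)]
    neighbours.  If two edges agree on all neighbours of [v] and both or none
    of them contain [v], then they agree on [v].  If they agree on all
    neighbours of [v] and exactly one contains [v], then they are [vu] and [uw]
    with [u] a neighbour of [v], and for each [u] there is at most one such [w]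
    for which [vu] and [uw] agree on [S :\ v], since all [uw] with [w != v] are
    at distance [1] from [v].  So [v] can be replaced by its neighbours [u] and
    these vertices [w], at most [2 * 2^(k-1)] in all (an isolated [v] is
    replaced by any other vertex, since a resolving set must be nonempty).
    Adding all of them to [S], for every [v \in S], gives a fault-tolerant
    set. *)

(* Distances are handled through their sublevel sets [n |-> (x <= n)], with
   [None] infinite: this turns minima into disjunctions. *)
Definition ole (x : option nat) (n : nat) : bool :=
  if x is Some m then m <= n else false.

Lemma ole_inj x y : ole x =1 ole y -> x = y.
Proof.
case: x y => [m|] [n|] //= mn.
- have /= := mn m; have /= := mn n; rewrite !leqnn => mln /esym nlm.
  by congr Some; apply/eqP; rewrite eqn_leq mln.
- by have /= := mn m; rewrite leqnn.
- by have /= := mn n; rewrite leqnn.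
Qed.

Lemma ole_omin x y n : ole (omin x y) n = ole x n || ole y n.
Proof. by case: x y => [i|] [j|] //=; rewrite ?geq_min ?orbF. Qed.

Lemma ole0 x : ole x 0 = (x == Some 0).
Proof. by case: x => [n|] //=; rewrite leqn0. Qed.

Section EdgeDistances.
Variable G : sgraph.
Implicit Types (u v w s : G) (A B S T : {set G}).

(** * Distances from a vertex in terms of its neighbours *)

Lemma ole_distP u v n :
  reflect (exists p, [/\ path (@adj G) u p, last u p = v & size p <= n])
          (ole (dist u v) n).
Proof.
apply: (iffP idP); rewrite /dist; case: {-}_ / idP => [uv|nuv] //=.
- case: ex_minnP => m /existsP[p /andP[up /eqP lp]] _ mn.
  by exists p; rewrite size_tuple.
- case: ex_minnP => m _ m_min [p [up lp szp]].
  apply: leq_trans szp; apply: m_min; apply/existsP; exists (in_tuple p).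
  by rewrite up lp eqxx.
- by case=> p [up lp _]; case: nuv; apply/connectP; exists p.
Qed.

Lemma ole_distS u v n :
  ole (dist u v) n.+1 = (u == v) || [exists x, adj u x && ole (dist x v) n].
Proof.
apply/ole_distP/orP => [[[|x p] /= [up lp szp]]|[/eqP->|]].
- by left; apply/eqP.
- have /andP[ux xp] := up; right; apply/existsP; exists x; rewrite ux.
  by apply/ole_distP; exists p.
- by exists [::].
- case/existsP=> x /andP[ux /ole_distP[p [xp lp szp]]].
  by exists (x :: p); rewrite /= ux.
Qed.

Lemma ole_dist_adjr s u v n :
  adj u v -> ole (dist s u) n -> ole (dist s v) n.+1.
Proof.
move=> uv /ole_distP[p [sp lp szp]]; apply/ole_distP.
by exists (rcons p v); rewrite rcons_path sp lp uv last_rcons size_rcons.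
Qed.

Lemma ole_edge_dist A w n :
  ole (edge_dist A w) n = [exists u in A, ole (dist w u) n].
Proof.
by rewrite -big_orE; apply: (big_morph (ole^~ n)) => // x y; rewrite ole_omin.
Qed.

Lemma ole_edge_distS A v n :
  ole (edge_dist A v) n.+1
    = (v \in A) || [exists x, adj v x && ole (edge_dist A x) n].
Proof.
rewrite ole_edge_dist; apply/existsP/orP => [[u /andP[uA]]|[vA|]].
- rewrite ole_distS => /orP[/eqP->|/existsP[x /andP[vx xu]]]; first by left.
  right; apply/existsP; exists x; rewrite vx ole_edge_dist /=.
  by apply/existsP; exists u; rewrite uA.
- by exists v; rewrite vA ole_distS eqxx.
- case/existsP=> x /andP[vx]; rewrite ole_edge_dist.
  case/existsP=> u /andP[uA xu]; exists u; rewrite uA ole_distS.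
  by apply/orP; right; apply/existsP; exists x; rewrite vx.
Qed.

(** Sublevel 0 is membership, and each later sublevel at [v] is given by membership and the
    preceding sublevel at the neighbours. *)
Lemma edge_dist_eq_nbrs A B v :
    (forall u, adj v u -> edge_dist A u = edge_dist B u) ->
  (v \in A) = (v \in B) -> edge_dist A v = edge_dist B v.
Proof.
move=> nbrAB vAB; apply: ole_inj => -[|n].
  by rewrite !ole0 !edge_dist_eq0.
rewrite !ole_edge_distS vAB; congr (_ || _); apply: eq_existsb => u.
by case vu: (adj v u) => //=; rewrite nbrAB.
Qed.

(** * Edges at a vertex, and separation *)

Lemma adj_neq u v : adj u v -> u != v.
Proof. by apply: contraTneq => ->; rewrite adj_irrefl. Qed.

Lemma mem_edges u v : adj u v -> [set u; v] \in edges G.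
Proof.
by move=> uv; rewrite inE; apply/existsP; exists u; apply/existsP; exists v;
   rewrite uv eqxx.
Qed.

Lemma edge_inP A v :
  A \in edges G -> v \in A -> exists2 u, adj v u & A = [set v; u].
Proof.
rewrite inE => /existsP[x /existsP[y /andP[xy /eqP->]]].
rewrite !inE => /orP[/eqP->|/eqP->]; first by exists y.
by exists x; [rewrite adj_sym | rewrite setUC].
Qed.

Lemma set2_injr v u w : v != u -> [set v; u] = [set v; w] -> u = w.
Proof.
move=> vu /setP/(_ u); rewrite !inE eqxx orbT eq_sym (negbTE vu).
by move/esym/eqP.
Qed.

(** Walks extend across the edge, so the distances from [s] to [u] and [v] differ by at most 1 or
    are both infinite. Given [dist s v], the edge distance thus carries one bit. *)
Lemma edge_dist_nbr s v u : adj v u ->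
    edge_dist [set v; u] s != dist s v ->
  edge_dist [set v; u] s = omap predn (dist s v).
Proof.
move=> vu; rewrite edge_dist2 ?adj_neq //.
have vus n := @ole_dist_adjr s v u n vu.
have uvs n := @ole_dist_adjr s u v n (etrans (adj_sym _ _) vu).
case: (dist s v) vus uvs => [i|] vus; case: (dist s u) vus => [j|] vus uvs.
- have /= ij := uvs j (leqnn j).
  have [_|ltji _] := leqP i j; first by rewrite eqxx.
  by have -> : i = j.+1 by apply/eqP; rewrite eqn_leq ij ltji.
- by have := vus i (leqnn i).
- by have := uvs j (leqnn j).
- by [].
Qed.

(** Nonemptiness is kept apart: replacing an isolated [v] in [S = {v}] can leave the empty set. *)
Definition separates_edges S : Prop :=
  {in edges G &, forall A B, {in S, edge_dist A =1 edge_dist B} -> A = B}.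

Lemma edge_resolvingP S :
  reflect (S != set0 /\ separates_edges S) (edge_resolving S).
Proof.
apply: (iffP andP) => -[S0 sepS]; split=> //.
  move=> A B eA eB AB; have /'forall_implyP/(_ A eA) := sepS.
  move=> /'forall_implyP/(_ B eB)/implyP h; apply/eqP/h.
  by apply/'forall_implyP => s /AB->.
apply/'forall_implyP => A eA; apply/'forall_implyP => B eB.
apply/implyP => /'forall_implyP AB; apply/eqP/sepS => // s sS.
exact/eqP/AB.
Qed.

Lemma separates_edges_sub S T :
  S \subset T -> separates_edges S -> separates_edges T.
Proof.
by move=> /subsetP ST sepS A B eA eB AB; apply: sepS => // s /ST/AB.
Qed.

(** * Replacing one vertex *)

Definition nbrs v : {set G} := [set u | adj v u].

Lemma card_nbrs S v :
  separates_edges S -> v \in S -> #|nbrs v| <= 2 ^ #|S|.-1.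
Proof.
move=> sepS vS.
(* [f u] collects the bits of the edge [vu]; they fix its distances from [S :\ v], and its distance
   from [v] is 0. *)
pose f u := [set s in S :\ v | edge_dist [set v; u] s != dist s v].
have f_inj : {in nbrs v &, injective f}.
  move=> u w; rewrite !inE => vu vw fuw.
  apply: (@set2_injr v); rewrite ?adj_neq //.
  apply: sepS; rewrite ?mem_edges // => s sS.
  have [->|sv] := eqVneq s v.
    have d0 x : edge_dist [set v; x] v = Some 0.
      by apply/eqP; rewrite edge_dist_eq0 !inE eqxx.
    by rewrite !d0.
  have /setP/(_ s) := fuw; rewrite !inE sv sS /=.
  have := edge_dist_nbr (s := s) vu; have := edge_dist_nbr (s := s) vw.
  case: eqP => [->|_] wE; case: eqP => [->|_] uE //= _.
  by rewrite uE // wE.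
rewrite -(card_in_imset f_inj).
have -> : 2 ^ #|S|.-1 = #|powerset (S :\ v)|.
  by rewrite card_powerset (cardsD1 v S) vS.
apply/subset_leq_card/subsetP => _ /imsetP[u _ ->]; rewrite powersetE.
by apply/subsetP => s; rewrite inE => /andP[].
Qed.

Lemma edge_replacement S v : separates_edges S -> v \in S ->
  exists T : {set G}, [/\ v \notin T, #|T| <= 2 ^ #|S|
                      & separates_edges (S :\ v :|: T)].
Proof.
move=> sepS vS.
(* The condition [w != v] excludes the edge [vu] itself. *)
pose twin u w := [&& w != v, adj u w &
  [forall s in S :\ v, edge_dist [set v; u] s == edge_dist [set u; w] s]].
(* The default [u] is already a neighbour of [v], so it adds nothing. *)
pose g u := odflt u [pick w | twin u w].
exists (nbrs v :|: g @: nbrs v); split.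
- rewrite !inE adj_irrefl /=; apply/imsetP => -[u]; rewrite inE => vu.
  rewrite /g; case: pickP => [w /and3P[wv _ _]|_] /= vE.
    by rewrite vE eqxx in wv.
  by rewrite -vE adj_irrefl in vu.
- apply: leq_trans (leq_card_setU _ _) _.
  have -> : 2 ^ #|S| = 2 ^ #|S|.-1 + 2 ^ #|S|.-1.
    by rewrite addnn -mul2n -expnS (cardsD1 v S) vS.
  by apply: leq_add; rewrite ?(leq_trans (leq_imset_card _ _)) ?card_nbrs.
move=> A B; wlog vAB : A B / (v \in B) ==> (v \in A) => [wl|].
  move=> eA eB AB; case vAB: ((v \in B) ==> (v \in A)); first exact: wl.
  apply/esym/wl => // [|s /AB //].
  by move: vAB; case: (v \in A); case: (v \in B).
move=> eA eB AB.
have nbrAB u : adj v u -> edge_dist A u = edge_dist B u.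
  by move=> vu; apply: AB; rewrite !inE vu orbT.
have sAB s : s \in S -> s != v -> edge_dist A s = edge_dist B s.
  by move=> sS sv; apply: AB; rewrite !inE sv sS.
have [vE|vNE] := eqVneq (v \in A) (v \in B).
  apply: sepS => // s sS; have [->|sv] := eqVneq s v; last exact: sAB.
  exact: edge_dist_eq_nbrs.
have [vA vB] : v \in A /\ v \notin B.
  by move: vAB vNE; case: (v \in A); case: (v \in B).
have [u vu AE] := edge_inP eA vA.
have uB : u \in B.
  by rewrite -edge_dist_eq0 -nbrAB // edge_dist_eq0 AE !inE eqxx orbT.
have [w uw BE] := edge_inP eB uB.
have wv : w != v by apply: contraNneq vB => <-; rewrite BE !inE eqxx orbT.
have twinP x : twin u x -> forall s, s \in S -> s != v ->
    edge_dist [set v; u] s = edge_dist [set u; x] s.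
  by case/and3P=> _ _ /'forall_implyP xS s sS sv; apply/eqP/xS; rewrite !inE sv.
have uw_twin : twin u w.
  rewrite /twin wv uw; apply/'forall_implyP => s; rewrite !inE => /andP[sv sS].
  by rewrite -AE -BE sAB.
(* The twin picked by [g] must be [w]: two twin edges at [u] agree on [S :\ v], and both are at
   distance 1 from [v]. *)
have guw : g u = w.
  rewrite /g; case: pickP => [x ux|/(_ w)]; last by rewrite uw_twin.
  have /and3P[xv ux' _] := ux.
  apply: (@set2_injr u); rewrite ?adj_neq //.
  apply: sepS; rewrite ?mem_edges // => s sS; have [->|sv] := eqVneq s v.
    have vuy y : y != v -> v \in [set u; y] = false.
      move=> yv; rewrite !inE !(eq_sym v) (negbTE yv).
      by rewrite eq_sym (negbTE (adj_neq vu)).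
    apply: ole_inj => -[|n]; first by rewrite !ole0 !edge_dist_eq0 !vuy.
    have vuyS y : ole (edge_dist [set u; y] v) n.+1.
      rewrite ole_edge_distS; apply/orP; right; apply/existsP; exists u.
      rewrite vu; have /eqP-> : edge_dist [set u; y] u == Some 0 => //.
      by rewrite edge_dist_eq0 !inE eqxx.
    by rewrite !vuyS.
  by rewrite -(twinP x) // (twinP w).
(* Since [w = g u] lies in the new set and is at distance 0 from [B], it is at distance 0 from
   [A = {v, u}], which forces the loop [w = u]. *)
have : w \in A.
  rewrite -edge_dist_eq0 AB ?edge_dist_eq0 ?BE ?inE ?eqxx ?orbT //.
  by apply/orP; right; apply/orP; right; rewrite -guw imset_f // inE.
rewrite AE !inE (negbTE wv) /= eq_sym => /eqP uwE.
by rewrite uwE adj_irrefl in uw.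
Qed.

Lemma edge_replacement_neq0 S v :
    1 < #|G| -> separates_edges S -> v \in S ->
  exists T : {set G}, [/\ v \notin T, T != set0, #|T| <= 2 ^ #|S|
                      & separates_edges (S :\ v :|: T)].
Proof.
move=> G1 sepS vS; have [T [vT cT sepT]] := edge_replacement sepS vS.
have [T0|] := eqVneq T set0; last by exists T.
have /card_gt0P[y] : 0 < #|[set~ v]| by rewrite cardsC1 -subn1 subn_gt0.
rewrite !inE => yv; exists [set y]; split.
- by rewrite inE eq_sym.
- by rewrite -card_gt0 cards1.
- by rewrite cards1 expn_gt0.
- by apply: separates_edges_sub sepT; rewrite T0 setU0 subsetUl.
Qed.

(** * Union of all replacements *)

Lemma ft_edge_resolving_of_resolving S : 1 < #|G| -> edge_resolving S ->
  exists2 T : {set G}, ft_edge_resolving T & #|T| <= #|S| * (1 + 2 ^ #|S|).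
Proof.
move=> G1 /edge_resolvingP[S0 sepS].
have /fin_all_exists[T TP] v : exists T : {set G}, v \in S ->
    [/\ v \notin T, T != set0, #|T| <= 2 ^ #|S|
       & separates_edges (S :\ v :|: T)].
  have [vS|_] := boolP (v \in S); last by exists set0.
  by have [T TP] := edge_replacement_neq0 G1 sepS vS; exists T.
exists (S :|: \bigcup_(v in S) T v).
  apply/andP; split.
    by apply: contraNneq S0 => U0; rewrite -subset0 -U0 subsetUl.
  apply/'forall_implyP => s _; apply/edge_resolvingP.
  (* Without [s \in S] the union still contains [S :\ s :|: T s], because [s] is not in [T s];
     without any other [s] it contains [S]. *)
  have [sS|sNS] := boolP (s \in S).
    have [sT T0 _ sepT] := TP s sS.
    have sub : S :\ s :|: T s \subset (S :|: \bigcup_(v in S) T v) :\ s.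
      rewrite setDUl setUS // subsetD1 sT andbT; exact: bigcup_sup.
    split; last exact: separates_edges_sub sub sepT.
    apply: contraNneq T0 => U0; rewrite -subset0 -U0.
    exact: subset_trans (subsetUr _ _) sub.
  have sub : S \subset (S :|: \bigcup_(v in S) T v) :\ s.
    by rewrite subsetD1 sNS subsetUl.
  split; last exact: separates_edges_sub sub sepS.
  by apply: contraNneq S0 => U0; rewrite -subset0 -U0.
apply: leq_trans (leq_card_setU _ _) _; rewrite mulnDr muln1 leq_add2l.
rewrite -sum_nat_const.
apply: (@leq_trans (\sum_(v in S) #|T v|)); last first.
  by apply: leq_sum => v /TP[].
apply: (big_ind2 (fun (X : {set G}) n => #|X| <= n)) => //.
  by rewrite cards0.
move=> X m Y n Xm Yn; apply: leq_trans (leq_card_setU _ _) _; exact: leq_add.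
Qed.

End EdgeDistances.

Theorem theorem11 (G : sgraph) (hG : 1 < #|G|) :
  ftedim G <= edim G * (1 + 2 ^ edim G).
Proof.
rewrite /edim; case: arg_minnP => [|S resS _].
  exact/edge_resolvingT/ltnW.
have [T ftT leT] := ft_edge_resolving_of_resolving hG resS.
apply: leq_trans leT; rewrite /ftedim.
by case: arg_minnP => [|U _]; [exact: ft_edge_resolvingT | apply].
Qed.
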